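(* Let $p\in(1,\infty)$, $X\in\mathfrak A_p$, $\theta\in[0,p)$, $S\in\mathcal{LCR}_\theta(X)$ closed, and $\{\mathfrak m_k\}\in\mathfrak M_\theta(S)$ with parameter $\epsilon\in(0,\frac1{10}]$. Let $c\ge1$. Then there is $C>0$ such that $\operatorname{BSN}^1_{p,c}(f)\le C\operatorname{CN}_p(f)$ for all $f\in L^1_{loc}(\{\mathfrak m_k\})$. Furthermore, for each $\delta\in(0,\frac1{4c}]$ there is $C_\delta>0$ such that for all $f\in L^1_{loc}(\{\mathfrak m_k\})$, $$\big|\operatorname{BSN}^\delta_{p,c}(f)-\|f\|_{L^p(\mathfrak m_0)}\big|\le C_\delta\,\|f^\sharp\|_{L^p(U_{(c+1)\delta}(S),\mu)},$$ where $U_t(S)=\{x\in X:\operatorname{dist}(x,S)<t\}$.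
   Context: A metric measure space is a triple $X=(X,d,\mu)$ with $(X,d)$ a complete separable metric space and $\mu$ a Borel regular measure with $0<\mu(B)<\infty$ for every ball $B$ and $\operatorname{supp}\mu=X$. All balls are closed: $B_r(x)=\{y:d(x,y)\le r\}$; $\lambda B_r(x)=B_{\lambda r}(x)$, $r(B)$ is the radius. A measure on $X$ means a nonzero Borel regular locally finite (outer) measure. $\mu$ is uniformly locally doubling if for every $R>0$, $\sup_{r\in(0,R]}\sup_x\mu(B_{2r}(x))/\mu(B_r(x))<\infty$. $\operatorname{lip}f(x)=\limsup_{y\to x}|f(y)-f(x)|/d(x,y)$ at accumulation points and $0$ otherwise. For a measure $\mathfrak m$ and Borel $G$ with $0<\mathfrak m(G)<\infty$, $\mathcal E_{\mathfrak m}(f,G)=\inf_{c\in\mathbb R}\frac1{\mathfrak m(G)}\int_G|f-c|d\mathfrak m$. $X\in\mathfrak A_q$ if $\mu$ is uniformly locally doubling and for every $R>0$ there are $C>0,\lambda\ge1$ with $\mathcal E_\mu(f,B_r(x))\le Cr(\frac1{\mu(B_{\lambda r}(x))}\int_{B_{\lambda r}(x)}(\operatorname{lip}f)^qd\mu)^{1/q}$ for all Lipschitz $f$, $x$, $r\in(0,R]$. For $\theta\ge0$: $\mathcal H_{\theta,\delta}(E)=\inf\{\sum_i\mu(B_{r_i}(x_i))/r_i^\theta:E\subset\bigcup_iB_{r_i}(x_i),\ r_i<\delta\}$. $S\in\mathcal{LCR}_\theta(X)$ if there is $\lambda>0$ with $\mathcal H_{\theta,r}(B_r(x)\cap S)\ge\lambda\mu(B_r(x))/r^\theta$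 for all $x\in S$, $r\in(0,1]$. $\{\mathfrak m_k\}_{k=0}^\infty\in\mathfrak M_\theta(S)$ (parameter $\epsilon$) means: (M1) $\operatorname{supp}\mathfrak m_k=S$; (M2) $\exists C_1$: $\mathfrak m_k(B_r(x))\le C_1\mu(B_r(x))/r^\theta$ for all $k$, $x\in X$, $r\in(0,\epsilon^k]$; (M3) $\exists C_2$: $\mathfrak m_k(B_r(x))\ge C_2\mu(B_r(x))/r^\theta$ for all $k$, $x\in S$, $r\in[\epsilon^k,1]$; (M4) $\mathfrak m_k=w_k\mathfrak m_0$, $w_k\in L^\infty(\mathfrak m_0)$, $\exists C_3$: $\epsilon^{\theta j}/C_3\le w_k/w_{k+j}\le C_3$ $\mathfrak m_0$-a.e. on $S$ for all $k,j$. $L^1_{loc}(\{\mathfrak m_k\})=\bigcap_kL^1_{loc}(\mathfrak m_k)$. For $r>0$, $k(r)=\max\{k\in\mathbb Z:r\le\epsilon^k\}$; $k(B)=k(r(B))$. $\widetilde{\mathcal E}_{\mathfrak m}(f,B_r(x))=\mathcal E_{\mathfrak m}(f,B_{2r}(x))$ if $B_r(x)\cap\operatorname{supp}\mathfrak m\ne\emptyset$, else $0$. $f^\sharp(x)=\sup_{r\in(0,1]}r^{-1}\widetilde{\mathcal E}_{\mathfrak m_{k(r)}}(f,B_r(x))$ for $x\in X$; $\operatorname{CN}_p(f)=\|f\|_{L^p(\mathfrak m_0)}+\|f^\sharp\|_{L^p(\mu)}$. A finite family of closed balls $\{B_{r_i}(x_i)\}$ is $(S,c,\delta)$-nice if the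 balls are pairwise disjoint, $\max_ir_i\le\delta$, and $B_{cr_i}(x_i)\cap S\ne\emptyset$ for all $i$. $\operatorname{BSN}^\delta_{p,c}(f)=\|f\|_{L^p(\mathfrak m_0)}+\sup\big(\sum_{B\in\mathcal B}\mu(B)r(B)^{-p}\widetilde{\mathcal E}_{\mathfrak m_{k(B)}}(f,cB)^p\big)^{1/p}$, supremum over all $(S,c,\delta)$-nice families.
   Formalization: The second inequality is stated only for f with finite L^p(m_0) norm; otherwise its left side is the undefined difference of two infinities (for example f = 1 on an S of infinite m_0-measure). *)

(* Defs.v *)
From HB Require Import structures.
From mathcomp Require Import all_boot all_order all_algebra.
From mathcomp Require Import all_classical all_reals all_analysis.
Set Implicit Arguments. Unset Strict Implicit. Unset Printing Implicit Defensive.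
Import Order.TTheory GRing.Theory Num.Theory.
Import numFieldNormedType.Exports.
Local Open Scope classical_set_scope.
Local Open Scope ring_scope.

Section MMS.
Context {R : realType} {d : measure_display} {X : measurableType d}.
Variable dist : X -> X -> R.

Definition cball (x : X) (r : R) : set X := [set y | dist x y <= r].
Definition oball (x : X) (r : R) : set X := [set y | dist x y < r].

Definition is_metric : Prop :=
  [/\ forall x y, 0 <= dist x y,
      forall x y, dist x y = 0 <-> x = y,
      forall x y, dist x y = dist y x &
      forall x y z, dist x z <= dist x y + dist y z].

Definition dcauchy (u : nat -> X) : Prop :=
  forall e, 0 < e -> exists N, forall m n, (N <= m)%N -> (N <= n)%N ->
    dist (u m) (u n) < e.
Definition dcvg (u : nat -> X) (l : X) : Prop :=
  forall e, 0 < e -> exists N, forall n, (N <= n)%N -> dist (u n) l < e.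
Definition dcomplete : Prop := forall u, dcauchy u -> exists l, dcvg u l.
Definition dseparable : Prop :=
  exists D : set X, countable D /\
    forall x e, 0 < e -> exists y, D y /\ dist x y < e.

Definition dopen (U : set X) : Prop :=
  forall x, U x -> exists r, 0 < r /\ oball x r `<=` U.
Definition dclosed (S : set X) : Prop :=
  forall x, (forall r, 0 < r -> exists s, S s /\ dist x s < r) -> S x.

Definition borel_sigma : Prop :=
  (@measurable d X) = <<s [set U | dopen U] >>.

Definition msupp (m : {measure set X -> \bar R}) : set X :=
  [set x | forall r, 0 < r -> (0 < m (oball x r))%E].

Definition measure_on (m : {measure set X -> \bar R}) : Prop :=
  (0 < m setT)%E /\ forall x, exists r, 0 < r /\ (m (oball x r) < +oo)%E.

Definition mm_space (mu : {measure set X -> \bar R}) : Prop :=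
  [/\ is_metric, dcomplete, dseparable & borel_sigma] /\
  (forall x r, 0 < r -> (0 < mu (cball x r) < +oo)%E) /\
  msupp mu = setT.

Definition unif_loc_doubling (mu : {measure set X -> \bar R}) : Prop :=
  forall Rr, 0 < Rr -> exists C : R, forall x r, 0 < r -> r <= Rr ->
    (mu (cball x (2 * r)) <= C%:E * mu (cball x r))%E.

Definition acc_pt (x : X) : Prop :=
  forall r, 0 < r -> exists y, y <> x /\ dist x y < r.

Definition lip (f : X -> R) (x : X) : \bar R :=
  if `[< acc_pt x >] then
    ereal_inf [set ereal_sup [set (`|f y - f x| / dist x y)%:E
                              | y in [set y | y <> x /\ dist x y < r]]
              | r in [set r : R | 0 < r]]
  else 0%E.

Definition lipschitz (f : X -> R) : Prop :=
  exists L : R, forall x y, `|f x - f y| <= L * dist x y.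

Definition Eosc (m : {measure set X -> \bar R}) (f : X -> R) (G : set X)
  : \bar R :=
  ereal_inf [set (((fine (m G))^-1)%:E * \int[m]_(x in G) (`|f x - c|)%:E)%E
            | c in [set: R]].

Definition in_A (q : R) (mu : {measure set X -> \bar R}) : Prop :=
  unif_loc_doubling mu /\
  forall Rr, 0 < Rr -> exists C lam : R, 0 < C /\ 1 <= lam /\
    forall f, lipschitz f -> forall x r, 0 < r -> r <= Rr ->
      (Eosc mu f (cball x r) <=
       (C * r)%:E * poweR
         (((fine (mu (cball x (lam * r))))^-1)%:E *
          \int[mu]_(y in cball x (lam * r)) poweR (lip f y) q) q^-1)%E.

Definition cover_ball (b : option (X * R)) : set X :=
  match b with None => set0 | Some (x, r) => cball x r end.
Definition cover_term (mu : {measure set X -> \bar R}) (θ : R)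
  (b : option (X * R)) : \bar R :=
  match b with
  | None => 0%E
  | Some (x, r) => (mu (cball x r) * ((r `^ θ)^-1)%:E)%E
  end.
(* countable (possibly finite: None entries are absent balls) covers *)
Definition Hcont (mu : {measure set X -> \bar R}) (θ δ : R) (E : set X)
  : \bar R :=
  ereal_inf [set (\sum_(i <oo) cover_term mu θ (c i))%E
            | c in [set c : nat -> option (X * R) |
                     (forall i x r, c i = Some (x, r) -> 0 < r < δ) /\
                     E `<=` \bigcup_i cover_ball (c i)]].

Definition LCR (mu : {measure set X -> \bar R}) (θ : R) (S : set X) : Prop :=
  exists lam : R, 0 < lam /\ forall x r, S x -> 0 < r -> r <= 1 ->
    (lam%:E * mu (cball x r) * ((r `^ θ)^-1)%:E
     <= Hcont mu θ r (cball x r `&` S))%E.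

Definition Mfam (mu : {measure set X -> \bar R}) (θ : R) (S : set X) (eps : R)
  (m : nat -> {measure set X -> \bar R}) : Prop :=
  (forall k, measure_on (m k)) /\
  (* M1 *) (forall k, msupp (m k) = S) /\
  (* M2 *) (exists C1 : R, 0 < C1 /\ forall k x r, 0 < r -> r <= eps ^+ k ->
              (m k (cball x r) <= C1%:E * mu (cball x r) * ((r `^ θ)^-1)%:E)%E) /\
  (* M3 *) (exists C2 : R, 0 < C2 /\ forall k x r, S x -> eps ^+ k <= r -> r <= 1 ->
              (C2%:E * mu (cball x r) * ((r `^ θ)^-1)%:E <= m k (cball x r))%E) /\
  (* M4 *) (exists w : nat -> X -> R,
              (forall k, measurable_fun setT (w k) /\
                 (exists M : R, {ae m 0%N, forall x, `|w k x| <= M}) /\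
                 forall A, measurable A ->
                   m k A = (\int[m 0%N]_(x in A) (w k x)%:E)%E) /\
              exists C3 : R, 0 < C3 /\ forall k j,
                {ae m 0%N, forall x, S x ->
                   eps `^ (θ * j%:R) / C3 <= w k x / w (k + j)%N x <= C3}).

Definition L1loc (m : nat -> {measure set X -> \bar R}) (f : X -> R) : Prop :=
  measurable_fun setT f /\
  forall k x, exists r, 0 < r /\ (m k).-integrable (cball x r) (EFin \o f).

(* k(r) = max{k : r <= eps^k}; only used for r in (0,1], where k(r) >= 0 *)
Definition kidx (eps r : R) : nat :=
  xget 0%N [set n : nat | r <= eps ^+ n /\
                          forall n', r <= eps ^+ n' -> (n' <= n)%N].

Definition tEosc (m : {measure set X -> \bar R}) (f : X -> R) (x : X) (r : R)
  : \bar R :=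
  if `[< cball x r `&` msupp m !=set0 >] then Eosc m f (cball x (2 * r))
  else 0%E.

Definition sharp (eps : R) (m : nat -> {measure set X -> \bar R}) (f : X -> R)
  (x : X) : \bar R :=
  ereal_sup [set ((r^-1)%:E * tEosc (m (kidx eps r)) f x r)%E
            | r in [set r : R | 0 < r <= 1]].

Definition LpD (mu : {measure set X -> \bar R}) (D : set X) (p : R)
  (F : X -> \bar R) : \bar R :=
  poweR (\int[mu]_(x in D) poweR `|F x|%E p)%E p^-1.

Definition CN (mu : {measure set X -> \bar R}) (eps : R)
  (m : nat -> {measure set X -> \bar R}) (p : R) (f : X -> R) : \bar R :=
  (Lnorm (m 0%N) p%:E (EFin \o f) + Lnorm mu p%:E (sharp eps m f))%E.

Definition nice (S : set X) (c δ : R) (n : nat) (ctr : 'I_n -> X)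
  (rad : 'I_n -> R) : Prop :=
  (forall i, 0 < rad i) /\
  (forall i j, i <> j -> cball (ctr i) (rad i) `&` cball (ctr j) (rad j) = set0) /\
  (forall i, rad i <= δ) /\
  (forall i, cball (ctr i) (c * rad i) `&` S !=set0).

Definition BSN (mu : {measure set X -> \bar R}) (eps : R)
  (m : nat -> {measure set X -> \bar R}) (S : set X) (p c δ : R)
  (f : X -> R) : \bar R :=
  (Lnorm (m 0%N) p%:E (EFin \o f) +
   ereal_sup [set z | exists n ctr rad, nice S c δ ctr rad /\
     z = poweR (\sum_(i < n) (mu (cball (ctr i) (rad i)) *
                  (rad i `^ (- p))%:E *
                  poweR (tEosc (m (kidx eps (rad i))) f (ctr i) (c * rad i)) p))
               p^-1])%E.

Definition Unbhd (S : set X) (t : R) : set X :=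
  [set x | (ereal_inf [set (dist x s)%:E | s in S] < t%:E)%E].

End MMS.

(* Main.v *)
Require Import Defs.
From HB Require Import structures.
From mathcomp Require Import all_boot all_order all_algebra.
From mathcomp Require Import all_classical all_reals all_analysis.
From mathcomp Require Import measurable_realfun ring lra.
Import Order.TTheory GRing.Theory Num.Theory.
Local Open Scope classical_set_scope.
Local Open Scope ring_scope.

(** If the ball [B = B_r(x)] has [r <= 1/(4c)] and [cB] meets [S], then for each [y] in [B] the ball of
    radius [2(c+1)r] about [y] contains [2cB]. The conditions (M2), (M3), doubling and the
    comparability of [m_k] for nearby [k] (M4) show that both balls have comparable measure, so
    [r^-1] times the oscillation over [2cB] is at most [C f#(y)]. Raising this to the power [p] and
    integrating over the disjoint balls [B/2] bounds the sum over a nice family; halving the balls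
    keeps them inside the open neighbourhood [U_{(c+1)delta}(S)]. The balls with [r > 1/(4c)] only
    involve boundedly many [m_k], all comparable to [m_0], and their dilations [2cB] overlap
    boundedly, so Jensen's inequality bounds their part by [||f||_p]. *)

(** * Integral inequalities: change of measure, densities, Jensen *)

Section integrals.
Context {d : measure_display} {T : measurableType d} {R : realType}.
Local Open Scope ereal_scope.
Import HBNNSimple.
Implicit Types (m n : {measure set T -> \bar R}) (A B D : set T).

(* The library integral of a nonnegative function is a supremum over simple functions, so it is
   monotone even for nonmeasurable integrands; [sharp] is not known to be measurable. *)
Lemma ge0_le_integral_sub m A B (f g : T -> \bar R) :
  A `<=` B -> (forall x, A x -> 0 <= f x) -> (forall x, B x -> 0 <= g x) ->
  (forall x, A x -> f x <= g x) ->
  \int[m]_(x in A) f x <= \int[m]_(x in B) g x.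
Proof.
move=> AB f0 g0 fg; rewrite !ge0_integralE//.
apply: le_ereal_sup => _ [h /= hf <-]; exists h => // x.
apply: le_trans (hf x) _; rewrite !patchE.
case: ifPn => [/set_mem Ax|_]; first by rewrite mem_set; [exact: fg|exact: AB].
by case: ifPn => // /set_mem /g0.
Qed.

(** For a simple function the bound holds level set by level set; the integral is the supremum over
    the simple functions below the integrand, and this class is the same for [m] and [n]. *)
Lemma ge0_integral_le_scale m n (C : R) D (f : T -> \bar R) :
  (0 <= C)%R -> (forall A, measurable A -> m A <= C%:E * n A) ->
  (forall x, D x -> 0 <= f x) ->
  \int[m]_(x in D) f x <= C%:E * \int[n]_(x in D) f x.
Proof.
move=> C0 mn f0; rewrite !ge0_integralE//.
apply: ge_ereal_sup => _ [h /= hf <-].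
apply: (@le_trans _ _ (C%:E * sintegral n h)); last first.
  rewrite lee_wpmul2l ?lee_fin//; apply: ereal_sup_ubound; by exists h.
rewrite !sintegralE ge0_mule_fsumr; last first.
  by move=> r; rewrite nnsfun_mulemu_ge0.
apply: lee_fsum => // r.
have [r0|r0] := leP 0%R r; last first.
  by rewrite preimage_nnfun0// !measure0 !mule0.
rewrite muleCA lee_wpmul2l ?lee_fin//; exact: mn.
Qed.

(** The weights of (M4) are given as real functions without a sign. On [N = {w < 0}] the integral of
    [w] is minus that of its absolute value, yet equals [n N >= 0]; so [w] vanishes a.e. on [N],
    which makes [N] null. *)
Lemma density_ae_ge0 m n (w : T -> R) : measurable_fun setT w ->
  (forall A, measurable A -> n A = \int[m]_(x in A) (w x)%:E) ->
  {ae m, forall x, (0 <= w x)%R}.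
Proof.
move=> mw nE; set N := [set x | (w x < 0)%R].
have mN : measurable N.
  have -> : N = setT `&` w @^-1` `]-oo, 0%R[.
    by apply/seteqP; split => x /=; rewrite in_itv //= => -[].
  exact: mw.
exists N; split => //; last by move=> x /= /negP; rewrite -ltNge.
have mwN : measurable_fun N (EFin \o w).
  by apply/measurable_EFinP; exact: measurable_funS mw.
have I0 : \int[m]_(x in N) `|(EFin \o w) x| = 0.
  apply/eqP; rewrite eq_le integral_ge0// andbT.
  have E : \int[m]_(x in N) (w x)%:E = - (\int[m]_(x in N) `|(EFin \o w) x|).
    rewrite -integral_ge0N//.
    by apply: eq_integral => x /set_mem /= wx; rewrite ltr0_norm// opprK.
  by rewrite -oppe_ge0 -E -nE.
have /(ae_eq_integral_abs m mN mwN) [M [mM M0 NM]] := I0.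
apply: (subset_measure0 mN mM _ M0) => x Nx; apply: NM => /= /(_ Nx) [w0].
by move: Nx; rewrite /N /= w0 ltxx.
Qed.

Lemma density_le_scale m0 m n (w v : T -> R) (C : R) :
  (0 <= C)%R -> measurable_fun setT w -> measurable_fun setT v ->
  (forall A, measurable A -> m A = \int[m0]_(x in A) (w x)%:E) ->
  (forall A, measurable A -> n A = \int[m0]_(x in A) (v x)%:E) ->
  {ae m0, forall x, (w x <= C * v x)%R} ->
  forall A, measurable A -> m A <= C%:E * n A.
Proof.
move=> C0 mw mv mE nE wv A mA.
have w0 := density_ae_ge0 _ _ _ mw mE; have v0 := density_ae_ge0 _ _ _ mv nE.
(* Replacing an a.e. nonnegative density by its positive part gives an everywhere nonnegative
   integrand with the same integral. *)
have pos (u : T -> R) : measurable_fun setT u -> {ae m0, forall x, (0 <= u x)%R} ->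
    \int[m0]_(x in A) (u x)%:E = \int[m0]_(x in A) (Num.max (u x) 0)%:E.
  move=> mu u0; apply: ae_eq_integral => //.
  - by apply/measurable_EFinP; exact: measurable_funS mu.
  - apply/measurable_EFinP; apply: measurable_funS (measurableT) _ _ => //.
    by apply: measurable_maxr => //; exact: measurable_cst.
  - by apply: filterS u0 => x u0 Ax; rewrite max_l.
rewrite mE// nE// pos// [in leRHS]pos// -ge0_integralZl_EFin//; last 2 first.
- by move=> x _; rewrite lee_fin le_max lexx orbT.
- apply/measurable_EFinP; apply: measurable_funS (measurableT) _ _ => //.
  by apply: measurable_maxr => //; exact: measurable_cst.
apply: ae_ge0_le_integral => //.
- by move=> x _; rewrite lee_fin le_max lexx orbT.
- apply/measurable_EFinP; apply: measurable_funS (measurableT) _ _ => //.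
  by apply: measurable_maxr => //; exact: measurable_cst.
- by move=> x _; rewrite -EFinM lee_fin mulr_ge0// le_max lexx orbT.
- apply: emeasurable_funM; first exact: measurable_cst.
  apply/measurable_EFinP; apply: measurable_funS (measurableT) _ _ => //.
  by apply: measurable_maxr => //; exact: measurable_cst.
- near=> x => _; have h1 : (w x <= C * v x)%R by near: x.
  have h2 : (0 <= w x)%R by near: x.
  have h3 : (0 <= v x)%R by near: x.
  by rewrite -EFinM lee_fin !max_l.
Unshelve. all: by end_near.
Qed.

(** The sum is at most twice the larger summand. This covers exponents below 1, such as [p^-1]. *)
Lemma poweRD_le (a b : \bar R) (r : R) : (0 <= r)%R -> 0 <= a -> 0 <= b ->
  (a + b) `^ r <= (2 `^ r)%:E * (a `^ r + b `^ r).
Proof.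
move=> r0.
wlog ab : a b / a <= b.
  move=> H a0 b0; have [/H|/ltW /H] := leP a b; first exact.
  by rewrite addeC [X in _ * X]addeC; exact.
move=> a0 b0; apply: (@le_trans _ _ ((2%:E * b) `^ r)).
  apply: gt0_ler_poweR => //; rewrite ?in_itv/= ?leey ?andbT ?adde_ge0 ?mule_ge0//.
  by rewrite mule_natl mule2n leeD2r.
rewrite poweRM// poweR_EFin lee_wpmul2l ?lee_fin ?powR_ge0//.
by rewrite leeDr// poweR_ge0.
Qed.

(** Jensen's inequality for the mean over [G], from Hölder applied to [f 1_G] and [1_G] with
    exponents [p] and [(1 - p^-1)^-1]. The second norm is [m(G)^(1 - 1/p)]; its [p]-th power times
    [m(G)^(-p)] leaves [m(G)^(-1)]. *)
Lemma poweR_mean_le m (G : set T) (f : T -> R) (p : R) : (1 < p)%R ->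
  measurable G -> measurable_fun setT f -> 0 < m G -> m G < +oo ->
  (((fine (m G))^-1)%:E * \int[m]_(x in G) `|f x|%:E) `^ p <=
  ((fine (m G))^-1)%:E * \int[m]_(x in G) (`|f x|%:E `^ p).
Proof.
move=> p1 mG mf mG0 mGy.
have p0 : (0 < p)%R by rewrite (lt_trans _ p1).
have q0 : (0 < 1 - p^-1)%R by rewrite subr_gt0 invf_lt1.
have mGf : m G \is a fin_num by rewrite ge0_fin_numE.
have M0 : (0 < fine (m G))%R by rewrite fine_gt0// mG0.
have G1 : measurable_fun setT (\1_G : T -> R) by exact: measurable_indic.
have fG : measurable_fun setT (f \* \1_G)%R by exact: measurable_funM.
have H := @hoelder _ T R m (f \* \1_G)%R \1_G p ((1 - p^-1)^-1)%R fG G1 p0.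
have {}H := H _ _; rewrite invr_gt0 in H.
have {}H := H q0; rewrite invrK in H; have {}H := H (subrKC _ _).
rewrite Lnorm1 in H.
have E1 : \int[m]_x `|(f \* \1_G \* \1_G)%R x|%:E = \int[m]_(x in G) `|f x|%:E.
  rewrite [RHS]integral_mkcond; apply: eq_integral => x _.
  by rewrite patchE /= indicE; case: (x \in G); rewrite ?mulr1// mulr0 normr0.
have E2 : \int[m]_x (`|(f \* \1_G)%R x|%:E `^ p) = \int[m]_(x in G) (`|f x|%:E `^ p).
  rewrite [RHS]integral_mkcond; apply: eq_integral => x _.
  rewrite patchE /= indicE; case: (x \in G); rewrite ?mulr1// mulr0 normr0.
  by rewrite powR0 ?gt_eqF.
have E3 : 'N[m]_(1 - p^-1)^-1%:E[EFin \o \1_G] = m G `^ (1 - p^-1).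
  rewrite unlock invrK; congr poweR.
  rewrite -[RHS](mul1e) -(integral_cst m mG) [RHS]integral_mkcond.
  apply: eq_integral => x _.
  rewrite patchE /= indicE; case: (x \in G); rewrite ?normr1 ?normr0.
    by rewrite powR1.
  by rewrite powR0// invr_eq0 gt_eqF.
move: H; rewrite E1 E3 => H.
rewrite poweRM ?integral_ge0// ?lee_fin ?invr_ge0 ?(ltW M0)//.
apply: (@le_trans _ _ (((fine (m G))^-1)%:E `^ p *
  (\int[m]_(x in G) (`|f x|%:E `^ p) * m G `^ (p - 1)))).
  rewrite lee_wpmul2l ?poweR_ge0//.
  apply: le_trans (gt0_ler_poweR (ltW p0) _ _ H) _.
  - by rewrite in_itv/= leey integral_ge0.
  - by rewrite in_itv/= leey mule_ge0 ?Lnorm_ge0 ?poweR_ge0.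
  rewrite poweRM ?Lnorm_ge0 ?poweR_ge0// poweR_Lnorm ?gt_eqF//= E2.
  by rewrite -poweRrM mulrBl mul1r mulVf ?gt_eqF.
rewrite muleC -muleA muleC lee_wpmul2r ?integral_ge0//.
  by move=> x _; exact: poweR_ge0.
rewrite -(fineK mGf) !poweR_EFin -EFinM lee_fin /=.
rewrite powRB; last by apply/implyP => _; rewrite gt_eqF.
rewrite powRr1 ?(ltW M0)// mulrAC -powRM ?invr_ge0 ?(ltW M0)//.
by rewrite mulfV ?gt_eqF// powR1 mul1r.
Qed.

End integrals.

(** * Sums over disjoint or boundedly overlapping sets *)

Section sums.
Context {d : measure_display} {T : measurableType d} {R : realType}.
Variable m : {measure set T -> \bar R}.
Local Open Scope ereal_scope.

Lemma sum_ge0_integral n (P : pred 'I_n) (g : 'I_n -> T -> \bar R) :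
  (forall i, measurable_fun setT (g i)) -> (forall i x, 0 <= g i x) ->
  \sum_(i < n | P i) \int[m]_x g i x = \int[m]_x \sum_(i < n | P i) g i x.
Proof.
move=> mg g0; rewrite -big_filter -ge0_integral_sum//.
by apply: eq_integral => x _; rewrite big_filter.
Qed.

(** The left side is the integral of the step function with value [a i] on [B i], which by
    disjointness has at most one nonzero term at each point and so lies below [g]. Only the step
    function has to be measurable, so [g] may be a power of [sharp]. *)
Lemma sum_measure_le_integral n (P : pred 'I_n) (B : 'I_n -> set T)
    (a : 'I_n -> \bar R) (D : set T) (g : T -> \bar R) :
  (forall i, measurable (B i)) ->
  (forall i j, i <> j -> B i `&` B j = set0) ->
  (forall i, 0 <= a i) -> (forall x, D x -> 0 <= g x) ->
  (forall i x, P i -> B i x -> D x /\ a i <= g x) ->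
  \sum_(i < n | P i) a i * m (B i) <= \int[m]_(x in D) g x.
Proof.
move=> mB dB a0 g0 ag; have h0 i x : 0 <= (cst (a i) \_ (B i)) x.
  by rewrite patchE; case: ifP => // _; exact: a0.
have -> : \sum_(i < n | P i) a i * m (B i) =
    \sum_(i < n | P i) \int[m]_x (cst (a i) \_ (B i)) x.
  by apply: eq_bigr => i _; rewrite -integral_cst// integral_mkcond.
rewrite sum_ge0_integral//; last first.
  move=> i; apply/(measurable_restrictT _ (mB i)); exact: measurable_cst.
rewrite [leRHS]integral_mkcond; apply: ge0_le_integral_sub => //.
- by move=> x _; exact: sume_ge0.
- by move=> x _; rewrite patchE; case: ifPn => // /set_mem /g0.
move=> x _; have [[i [Pi Bix]]|nB] := pselect (exists i, P i /\ B i x).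
  have [Dx aig] := ag _ _ Pi Bix.
  rewrite (bigD1 i)//= big1 => [|j /andP[_ /eqP ji]].
    by rewrite adde0 !patchE !mem_set.
  rewrite patchE memNset// => Bjx.
  suff : (B j `&` B i) x by rewrite dB.
  by [].
rewrite big1 => [|i Pi]; last first.
  by rewrite patchE memNset// => Bix; apply: nB; exists i.
by rewrite patchE; case: ifPn => // /set_mem /g0.
Qed.

Lemma sum_integral_overlap_le n (P : pred 'I_n) (G : 'I_n -> set T)
    (g : T -> \bar R) (N : R) : (0 <= N)%R ->
  (forall i, measurable (G i)) -> measurable_fun setT g -> (forall x, 0 <= g x) ->
  (forall x, (\sum_(i < n | P i) \1_(G i) x <= N)%R) ->
  \sum_(i < n | P i) \int[m]_(x in G i) g x <= N%:E * \int[m]_x g x.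
Proof.
move=> N0 mG mg g0 GN.
have h0 i x : 0 <= (g \_ (G i)) x by rewrite patchE; case: ifP.
under eq_bigr do rewrite integral_mkcond.
rewrite sum_ge0_integral//; last first.
  move=> i; apply/(measurable_restrictT _ (mG i)); exact: measurable_funS mg.
rewrite -ge0_integralZl_EFin//; apply: ge0_le_integral_sub => //.
- by move=> x _; exact: sume_ge0.
- by move=> x _; rewrite mule_ge0.
move=> x _; have -> : \sum_(i < n | P i) (g \_ (G i)) x =
    \sum_(i < n | P i) (\1_(G i) x)%:E * g x.
  apply: eq_bigr => i _; rewrite patchE indicE.
  by case: ifP; rewrite ?mul1e ?mul0e.
rewrite -ge0_sume_distrl; last by move=> i _; rewrite lee_fin.
by rewrite lee_wpmul2r// sumEFin lee_fin.
Qed.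

End sums.

(** * Borel measurability of balls, supports, doubling *)

Section metric.
Context {R : realType} {d : measure_display} {X : measurableType d}.
Variable dist : X -> X -> R.
Hypothesis metricX : is_metric dist.
Hypothesis sepX : dseparable dist.
Hypothesis borelX : borel_sigma dist.

Let dist_sym x y : dist x y = dist y x. Proof. by case: metricX. Qed.
Let dist_tri x y z : dist x z <= dist x y + dist y z.
Proof. by case: metricX. Qed.

Lemma dopen_measurable U : dopen dist U -> measurable U.
Proof. by move=> oU; rewrite borelX; exact: sub_sigma_algebra. Qed.

Lemma measurable_cball x r : measurable (cball dist x r).
Proof.
rewrite -[X in measurable X]setCK; apply: measurableC; apply: dopen_measurable.
move=> y /= /negP; rewrite -ltNge => xy; exists (dist x y - r).
split; first by rewrite subr_gt0.
move=> z /= yz /= xz; have := dist_tri x z y; rewrite (dist_sym z y).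
by move: xz yz; rewrite /oball/cball/=; lra.
Qed.

Lemma measurable_oball x r : measurable (oball dist x r).
Proof.
apply: dopen_measurable => y /= xy; exists (r - dist x y).
split; first by rewrite subr_gt0.
move=> z yz; rewrite /oball/=; have := dist_tri x y z.
by move: yz; rewrite /oball/=; lra.
Qed.

Lemma cball_sub x y r s : dist x y + s <= r -> cball dist y s `<=` cball dist x r.
Proof.
by move=> h z; rewrite /cball/= => yz; have := dist_tri x y z; lra.
Qed.

(* Lindelof: the complement of the support is covered by countably many null balls. *)
Lemma ae_msupp (m : {measure set X -> \bar R}) : {ae m, forall x, msupp dist m x}.
Proof.
have [D [/countable_injP [f finj] Ddense]] := sepX.
(* [F n k] is the ball of radius [1/(k+1)] about the dense point numbered [n] if that ball is null,
   and empty otherwise. *)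
pose F n k := [set x | exists y, [/\ D y, f y = n,
  m (oball dist y k.+1%:R^-1) = 0%E & dist x y < k.+1%:R^-1]].
apply: (@negligibleS _ _ _ m (\bigcup_n \bigcup_k F n k)); last first.
  apply: negligible_bigcup => n; apply: negligible_bigcup => k.
  have [[x [y [Dy fy my _]]]|nF] := pselect (F n k !=set0); last first.
    apply: (@negligibleS _ _ _ m set0); last exact: negligible_set0.
    by move=> x Fx; apply: nF; exists x.
  exists (oball dist y k.+1%:R^-1); split => //; first exact: measurable_oball.
  move=> z [y' [Dy' fy' _ zy']]; suff <- : y' = y by rewrite /oball/= dist_sym.
  by apply: finj; rewrite ?mem_set// fy fy'.
move=> x /= /existsNP [r /not_implyP [r0 /negP mr]].
have {}mr : m (oball dist x r) = 0%E.
  by apply/eqP; rewrite -measure_le0 leNgt.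
(* With [1/(k+1) < r/2], a dense point [y] within [1/(k+1)] of [x] has its ball of that radius
   inside the null ball of radius [r] about [x]. *)
pose k := Num.trunc ((r / 2)^-1).
have kr : k.+1%:R^-1 < r / 2.
  by rewrite invf_plt ?posrE ?divr_gt0// /k truncnS_gt.
have [y [Dy xy]] : exists y, D y /\ dist x y < k.+1%:R^-1.
  by apply: Ddense; rewrite invr_gt0.
exists (f y) => //; exists k => //; exists y; split => //.
apply: (subset_measure0 (measurable_oball _ _) (measurable_oball _ _) _ mr) => z.
rewrite /oball/= => yz; have := dist_tri x y z; move: kr xy yz.
by move: k.+1%:R^-1 => e; lra.
Qed.

Section doubling.
Variable mu : {measure set X -> \bar R}.
Hypothesis dblX : unif_loc_doubling dist mu.

Let doublingN N Rr : 0 < Rr -> exists D : R, 0 < D /\ forall x r, 0 < r -> r <= Rr ->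
  (mu (cball dist x (2 ^+ N * r)) <= D%:E * mu (cball dist x r))%E.
Proof.
elim: N Rr => [|N IH] Rr R0.
  by exists 1; split => // x r _ _; rewrite expr0 !mul1r mul1e.
have [D [D0 HD]] := IH Rr R0.
have [C HC] := dblX (2 ^+ N * Rr) (mulr_gt0 (exprn_gt0 N (ltr0Sn _ 1)) R0).
(* The doubling constant [C] comes without a sign; the maximum with 1 makes it positive. *)
exists (Num.max C 1 * D); split => [|x r r0 rR].
  by rewrite mulr_gt0// lt_max ltr01 orbT.
have N0 : (0 : R) < 2 ^+ N by rewrite exprn_gt0.
rewrite exprS -mulrA; apply: le_trans (HC _ _ _ _) _.
- by rewrite mulr_gt0.
- by rewrite ler_pM2l.
apply: (@le_trans _ _ ((Num.max C 1)%:E * mu (cball dist x (2 ^+ N * r))))%E.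
  by rewrite lee_wpmul2r// lee_fin le_max lexx.
rewrite EFinM -muleA lee_wpmul2l ?HD// lee_fin le_max ler01 orbT//.
Qed.

(** The form of doubling used throughout: the second ball lies in the first one dilated by [M],
    hence by a power of 2 exceeding [M]. *)
Lemma doubling_ball M Rr : 0 < Rr -> exists D : R, 0 < D /\ forall x y r s,
  0 < r -> r <= Rr -> dist x y + s <= M * r ->
  (mu (cball dist y s) <= D%:E * mu (cball dist x r))%E.
Proof.
move=> R0; have [D [D0 HD]] := doublingN (Num.trunc M).+1 _ R0.
exists D; split => // x y r s r0 rR h; apply: le_trans (HD _ _ r0 rR).
rewrite le_measure ?inE//; try exact: measurable_cball.
apply: cball_sub; apply: le_trans h _; rewrite ler_pM2r//.
apply/ltW; apply: lt_le_trans (truncnS_gt M) _.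
by rewrite -natrX ler_nat ltnW// ltn_expl.
Qed.

End doubling.
End metric.

(** * The scale index [k(r)] *)

Section kidx.
Context {R : realType} (eps : R).
Hypothesis eps0 : 0 < eps.
Hypothesis eps2 : eps <= 2^-1.

Let eps1 : eps < 1. Proof. by move: eps2; lra. Qed.

Lemma exists_expr_lt (r : R) : 0 < r -> exists n, eps ^+ n < r.
Proof.
move=> r0; exists (Num.trunc r^-1).+1.
apply: (@le_lt_trans _ _ (2 ^- (Num.trunc r^-1).+1)).
  by rewrite -exprVn lerXn2r// ?nnegrE ?invr_ge0 ?ltW.
rewrite invf_plt ?posrE ?exprn_gt0//; apply: lt_trans (truncnS_gt _) _.
by rewrite -natrX ltr_nat ltn_expl.
Qed.

Lemma kidxP (r : R) : 0 < r -> r <= 1 ->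
  r <= eps ^+ kidx eps r /\ eps ^+ (kidx eps r).+1 < r.
Proof.
move=> r0 r1; have [n rn] := exists_expr_lt _ r0.
have ub (k : nat) : r <= eps ^+ k -> (k <= n)%N.
  move=> rk; have := lt_le_trans rn rk.
  by rewrite ltr_iXn2l//; exact: ltnW.
have ex : exists k, (fun k => r <= eps ^+ k) k by exists 0%N; rewrite expr0.
case: (ex_maxnP ex ub) => k rk kmax.
rewrite /kidx; set P := [set _ | _].
have : P (xget 0%N P) by apply: (@xgetPex _ 0%N P); exists k.
move=> [h1 h2]; split => //; rewrite ltNge; apply/negP => /h2.
by rewrite ltnn.
Qed.

Lemma kidx_le (r s : R) : 0 < r -> r <= s -> s <= 1 ->
  (kidx eps s <= kidx eps r)%N.
Proof.
move=> r0 rs s1; have [h1 _] := kidxP _ (lt_le_trans r0 rs) s1.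
have [_ h2] := kidxP _ r0 (le_trans rs s1).
have := lt_le_trans h2 (le_trans rs h1).
by rewrite ltr_iXn2l// ltnS.
Qed.

(** Comparable radii have indices at bounded distance. With [eps^J < 1/max(M, 1)], one has
    [eps^(k(s)+1+J) < s/max(M, 1) <= r <= eps^k(r)]. *)
Lemma kidx_close (M : R) : exists J, forall r s, 0 < r -> r <= s -> s <= 1 ->
  s <= M * r -> (kidx eps r <= kidx eps s + J)%N.
Proof.
have Mi0 : 0 < (Num.max M 1)^-1 by rewrite invr_gt0 lt_max ltr01 orbT.
have [J HJ] := exists_expr_lt _ Mi0.
exists J => r s r0 rs s1 sM.
have [h1 _] := kidxP _ r0 (le_trans rs s1).
have [_ h2] := kidxP _ (lt_le_trans r0 rs) s1.
have M0 : 0 < Num.max M 1 by rewrite lt_max ltr01 orbT.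
have : eps ^+ ((kidx eps s).+1 + J) < eps ^+ kidx eps r.
  apply: lt_le_trans h1; rewrite exprD.
  apply: (@lt_le_trans _ _ (s * (Num.max M 1)^-1)).
    by apply: ltr_pM; rewrite ?exprn_ge0 ?ltW.
  rewrite ler_pdivrMr//; apply: le_trans sM _.
  by rewrite mulrC ler_pM2l// le_max lexx.
by rewrite ltr_iXn2l// addSn ltnS.
Qed.

End kidx.

(** * Comparison of oscillations and of the measures [m k] *)

(** Both infima are compared at the same constant [a]: [A] pays for changing the measure in the
    integral, [B] for changing the normalising mass. *)
Lemma Eosc_le {R : realType} {d} {X : measurableType d}
    (m n : {measure set X -> \bar R}) (A B : R) (G G' : set X) (f : X -> R) :
  0 < A -> 0 < B ->
  (forall E, measurable E -> (m E <= A%:E * n E)%E) ->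
  measurable G -> measurable G' -> G `<=` G' ->
  (0 < m G)%E -> (n G' < +oo)%E -> (n G' <= B%:E * m G)%E ->
  (Eosc m f G <= (A * B)%:E * Eosc n f G')%E.
Proof.
move=> A0 B0 mn mG mG' GG' G0 G'y G'B.
have mGG' : (m G <= m G')%E by rewrite le_measure ?inE.
have G'0 : (0 < n G')%E.
  have := lt_le_trans G0 (le_trans mGG' (mn _ mG')).
  by rewrite pmule_rgt0// lte_fin.
have Gy : (m G < +oo)%E.
  apply: le_lt_trans (le_trans mGG' (mn _ mG')) _.
  by rewrite lte_mul_pinfty// ?lee_fin ?ltW.
have Gf : m G \is a fin_num by rewrite ge0_fin_numE.
have G'f : n G' \is a fin_num by rewrite ge0_fin_numE.
have fG0 : 0 < fine (m G) by rewrite fine_gt0// G0.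
have fG'0 : 0 < fine (n G') by rewrite fine_gt0// G'0.
rewrite -lee_pdivrMl ?mulr_gt0//; apply: le_ereal_inf_tmp => _ [a _ <-].
rewrite lee_pdivrMl ?mulr_gt0//.
apply: (@le_trans _ _ ((fine (m G))^-1%:E * \int[m]_(x in G) `|f x - a|%:E)%E).
  by apply: ereal_inf_lbound; exists a.
apply: (@le_trans _ _ ((fine (m G))^-1%:E * (A%:E * \int[n]_(x in G') `|f x - a|%:E))%E).
  rewrite lee_wpmul2l ?lee_fin ?invr_ge0 ?fine_ge0//.
  apply: (@le_trans _ _ (\int[m]_(x in G') `|f x - a|%:E)%E).
    exact: ge0_le_integral_sub.
  by apply: ge0_integral_le_scale; rewrite ?ltW.
rewrite !muleA lee_wpmul2r ?integral_ge0// -!EFinM lee_fin.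
rewrite [leLHS]mulrC -mulrA ler_pM2l// ler_pdivlMr//.
rewrite mulrC ler_pdivrMr// -lee_fin EFinM !fineK//.
Qed.

(** (M4) bounds the quotient of two weights on [S], which carries [m 0] by (M1); for index gaps up
    to [J] the bounds are uniform. *)
Lemma Mfam_compare {R : realType} {d} {X : measurableType d} (dist : X -> X -> R)
    (mu : {measure set X -> \bar R}) (θ eps : R) (S : set X)
    (m : nat -> {measure set X -> \bar R}) (J : nat) :
  is_metric dist -> dseparable dist -> borel_sigma dist ->
  0 <= θ -> 0 < eps -> eps <= 1 -> Mfam dist mu θ S eps m ->
  exists A : R, 0 < A /\ forall k l, (k <= l + J)%N -> (l <= k + J)%N ->
    forall E, measurable E -> (m k E <= A%:E * m l E)%E.
Proof.
move=> mX sX bX θ0 e0 e1 [_ [M1 [_ [_ [w [Hw [C3 [C30 HC]]]]]]]].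
pose q := eps `^ (θ * J%:R).
have q0 : 0 < q by rewrite powR_gt0.
have aeS : {ae m 0%N, forall x, S x} by rewrite -(M1 0%N); exact: ae_msupp.
have wle k j : {ae m 0%N, forall x,
    0 < w (k + j)%N x /\ eps `^ (θ * j%:R) / C3 * w (k + j)%N x <= w k x
      <= C3 * w (k + j)%N x}.
  have [mk [_ Ek]] := Hw k; have [ml [_ El]] := Hw (k + j)%N.
  have k0 := density_ae_ge0 _ _ _ mk Ek; have l0 := density_ae_ge0 _ _ _ ml El.
  apply: filterS (filterI (filterI l0 k0) (filterI aeS (HC k j))).
  move=> x [[{}l0 {}k0] [Sx /(_ Sx)]].
  (* If the denominator were 0, the quotient would be 0 by the convention for inverses, against the
     positive lower bound in (M4). *)
  have [w0|wl] := eqVneq (w (k + j)%N x) 0.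
    by rewrite w0 invr0 mulr0 => /andP[]; rewrite leNgt divr_gt0// powR_gt0.
  have {l0 wl}l0 : 0 < w (k + j)%N x by rewrite lt0r wl.
  move=> /andP[h1 h2]; split => //; apply/andP.
  by split; [rewrite -ler_pdivlMr|rewrite -ler_pdivrMr].
have up k j E : measurable E -> (m k E <= C3%:E * m (k + j)%N E)%E.
  have [mk [_ Ek]] := Hw k; have [ml [_ El]] := Hw (k + j)%N.
  apply: (density_le_scale _ _ _ _ _ _ (ltW C30) mk ml Ek El).
  by apply: filterS (wle k j) => x [_ /andP[]].
have down k j E : (j <= J)%N -> measurable E ->
    (m (k + j)%N E <= (C3 / q)%:E * m k E)%E.
  move=> jJ; have [mk [_ Ek]] := Hw k; have [ml [_ El]] := Hw (k + j)%N.
  have Cq0 : 0 <= C3 / q by rewrite divr_ge0 ?ltW.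
  apply: (density_le_scale _ _ _ _ _ _ Cq0 ml mk El Ek).
  apply: filterS (wle k j) => x [l0 /andP[h _]].
  (* As [eps <= 1], the largest gap [J] gives the smallest lower bound. *)
  have qj : q <= eps `^ (θ * j%:R).
    by rewrite ger_powR ?e0// ler_wpM2l// ler_nat.
  rewrite mulrAC ler_pdivlMr//; apply: le_trans (ler_wpM2l (ltW l0) qj) _.
  by move: h; rewrite mulrAC ler_pdivrMr// mulrC [leRHS]mulrC.
exists (Num.max C3 (C3 / q)); split; first by rewrite lt_max C30.
move=> k l kl lk E mE; have [le|/ltnW le] := leqP k l.
  rewrite -(subnKC le); apply: le_trans (up _ (l - k)%N _ mE) _.
  by rewrite lee_wpmul2r// lee_fin le_max lexx.
rewrite -{1}(subnKC le); apply: le_trans (down _ _ _ _ mE) _.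
  by rewrite leq_subLR.
by rewrite lee_wpmul2r// lee_fin le_max lexx orbT.
Qed.

(** * Pointwise control of the oscillation on a ball by [sharp] *)

Section balls.
Context {R : realType} {d : measure_display} {X : measurableType d}.
Variables (dist : X -> X -> R) (mu : {measure set X -> \bar R}).
Variables (θ eps c : R) (S : set X) (m : nat -> {measure set X -> \bar R}).
Hypotheses (mmsX : mm_space dist mu) (dblX : unif_loc_doubling dist mu).
Hypotheses (θ0 : 0 <= θ) (eps0 : 0 < eps) (eps10 : eps <= 10^-1).
Hypotheses (Mm : Mfam dist mu θ S eps m) (c1 : 1 <= c).

Let mX : is_metric dist. Proof. by case: mmsX => -[]. Qed.
Let sX : dseparable dist. Proof. by case: mmsX => -[]. Qed.
Let bX : borel_sigma dist. Proof. by case: mmsX => -[]. Qed.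
Let dist_sym x y : dist x y = dist y x. Proof. by case: mX. Qed.
Let eps2 : eps <= 2^-1. Proof. by apply: le_trans eps10 _; lra. Qed.
Let eps1 : eps <= 1. Proof. by apply: le_trans eps10 _; lra. Qed.
Let mball x r : measurable (cball dist x r). Proof. exact: measurable_cball. Qed.
Let c0 : 0 < c. Proof. exact: lt_le_trans c1. Qed.
Let mu_gt0 x r : 0 < r -> (0 < mu (cball dist x r))%E.
Proof. by case: mmsX => _ [h _] /(h x) /andP[]. Qed.
Let mu_fin x r : 0 < r -> (mu (cball dist x r) < +oo)%E.
Proof. by case: mmsX => _ [h _] /(h x) /andP[]. Qed.

Let k_ r := kidx eps r.

(** (M3) is applied at a point [s] of [S] in [cB]. It requires [eps^k <= r], whereas [k(r)] gives
    [r <= eps^k(r)]; hence it is used with index [k(r) + 1], and the gap of one index is closed by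
    [Mfam_compare]. *)
Lemma Mfam_ball_ge : exists L : R, 0 < L /\ forall x r, 0 < r -> r <= 1 ->
  cball dist x (c * r) `&` S !=set0 ->
  (mu (cball dist x r) * ((r `^ θ)^-1)%:E <= L%:E * m (k_ r) (cball dist x (2 * (c * r))))%E.
Proof.
have [D [D0 HD]] := doubling_ball _ mX bX _ dblX (c + 1) 1 ltr01.
have [A [A0 HA]] := Mfam_compare _ _ _ _ _ _ 1 mX sX bX θ0 eps0 eps1 Mm.
have [_ [_ [_ [[C2 [C20 HC2]] _]]]] := Mm.
exists (D / C2 * A); split; first by rewrite !mulr_gt0 ?invr_gt0.
move=> x r r0 r1 [s [/= xs Ss]]; rewrite /cball/= in xs.
have [_ kr] := kidxP _ eps0 eps2 _ r0 r1.
have rθ : (0 <= ((r `^ θ)^-1)%:E)%E by rewrite lee_fin invr_ge0 powR_ge0.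
have h1 : (mu (cball dist x r) <= D%:E * mu (cball dist s r))%E.
  by apply: HD => //; rewrite dist_sym; move: xs; nra.
have h2 := HC2 (k_ r).+1 s r Ss (ltW kr) r1.
have h3 : (m (k_ r).+1 (cball dist s r) <= A%:E * m (k_ r) (cball dist s r))%E.
  by apply: HA => //; rewrite ?addn1// (leq_trans (leqnSn _)).
have h4 : (m (k_ r) (cball dist s r) <= m (k_ r) (cball dist x (2 * (c * r))))%E.
  rewrite le_measure ?inE//; apply: cball_sub => //.
  have : r <= c * r by rewrite ler_peMl// ltW.
  by move: xs; lra.
apply: le_trans (lee_wpmul2r rθ h1) _.
rewrite -muleA -mulrA mulrC EFinM EFinM.
apply: (@le_trans _ _ (C2^-1%:E * D%:E * (A%:E * m (k_ r) (cball dist s r))))%E; last first.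
  rewrite -!muleA [leRHS](_ : _ = C2^-1%:E * (A%:E * (D%:E * m (k_ r) (cball dist x (2 * (c * r))))))%E.
    rewrite lee_wpmul2l ?lee_fin ?invr_ge0 ?(ltW C20)// muleCA.
    rewrite lee_wpmul2l ?lee_fin ?(ltW A0)// lee_wpmul2l ?lee_fin ?(ltW D0)//.
  by rewrite !muleA; congr (_ * _)%E; rewrite -!EFinM; congr EFin; ring.
apply: le_trans (lee_wpmul2l _ (le_trans h2 h3)); last first.
  by rewrite -EFinM lee_fin mulr_ge0 ?invr_ge0 ?ltW.
have E : (C2^-1%:E * D%:E * C2%:E = D%:E)%E.
  by rewrite -!EFinM; congr EFin; field; rewrite gt_eqF.
by rewrite !muleA E.
Qed.

(* (c + 1) r is the radius at which [sharp f y] controls the ball x r. *)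
Lemma Mfam_ball_le : exists U : R, 0 < U /\ forall x y r, 0 < r -> r <= (4 * c)^-1 ->
  dist x y <= r ->
  (m (k_ ((c + 1) * r)) (cball dist y (2 * ((c + 1) * r))) <=
   U%:E * (mu (cball dist x r) * ((r `^ θ)^-1)%:E))%E.
Proof.
have c4 : 0 < (4 * c)^-1 by rewrite invr_gt0 mulr_gt0.
have [D [D0 HD]] := doubling_ball _ mX bX _ dblX (2 * (c + 1) + 1) _ c4.
have [J HJ] := kidx_close _ eps0 eps2 2.
have [A [A0 HA]] := Mfam_compare _ _ _ _ _ _ J mX sX bX θ0 eps0 eps1 Mm.
have [_ [_ [[C1 [C10 HC1]] _]]] := Mm.
exists (A * C1 * D); split; first by rewrite !mulr_gt0.
move=> x y r r0 r4 xy; set ρ := (c + 1) * r.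
have ρ0 : 0 < ρ by rewrite mulr_gt0// addr_gt0.
have cr : 0 < c * r by exact: mulr_gt0.
have cr1 : r <= c * r by rewrite ler_peMl// ltW.
have rc : r * (4 * c) <= 1 by rewrite -ler_pdivlMr ?mulr_gt0// div1r.
(* This is where [r <= 1/(4c)] enters: [2(c+1)r <= 4cr <= 1]. *)
have ρ1 : 2 * ρ <= 1 by rewrite /ρ; move: rc cr1; lra.
have rρ : r <= 2 * ρ by rewrite /ρ; move: cr r0; lra.
have ρ2 : ρ <= 2 * ρ by move: ρ0; lra.
(* (M2) at radius [2ρ] is available for the index [k(2ρ)], which is then exchanged for [k(ρ)]. *)
have [k1 _] := kidxP _ eps0 eps2 _ (lt_le_trans r0 rρ) ρ1.
have h1 := HC1 _ y _ (lt_le_trans r0 rρ) k1.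
have h2 : (m (k_ ρ) (cball dist y (2 * ρ)) <=
    A%:E * m (k_ (2 * ρ)) (cball dist y (2 * ρ)))%E.
  apply: HA => //; first exact: HJ.
  apply: leq_trans (leq_addr _ _); exact: kidx_le.
have h3 : (mu (cball dist y (2 * ρ)) <= D%:E * mu (cball dist x r))%E.
  by apply: HD => //; rewrite /ρ; move: xy cr r0; lra.
have h4 : ((2 * ρ) `^ θ)^-1 <= (r `^ θ)^-1.
  rewrite lef_pV2 ?posrE ?powR_gt0//; last exact: lt_le_trans rρ.
  by apply: ge0_ler_powR => //; rewrite nnegrE ltW// (lt_le_trans r0).
apply: le_trans h2 _.
rewrite -!mulrA EFinM -muleA lee_wpmul2l ?lee_fin ?(ltW A0)//.
apply: le_trans h1 _; rewrite EFinM -!muleA lee_wpmul2l ?lee_fin ?(ltW C10)//.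
rewrite muleA; apply: lee_pmul => //.
by rewrite lee_fin invr_ge0 powR_ge0.
Qed.

(** The radius [ρ = (c+1)r] is a competitor in the supremum defining [sharp] at [y]. The two
    preceding mass bounds supply the ratio for [Eosc_le], and the factor [c + 1] converts [1/r] into
    [1/ρ]. *)
Lemma tEosc_le_sharp : exists C : R, 0 < C /\ forall f x y r, 0 < r -> r <= (4 * c)^-1 ->
  cball dist x (c * r) `&` S !=set0 -> dist x y <= r ->
  ((r^-1)%:E * tEosc dist (m (k_ r)) f x (c * r) <= C%:E * sharp dist eps m f y)%E.
Proof.
have [L [L0 HL]] := Mfam_ball_ge; have [U [U0 HU]] := Mfam_ball_le.
have [J HJ] := kidx_close _ eps0 eps2 (c + 1).
have [A [A0 HA]] := Mfam_compare _ _ _ _ _ _ J mX sX bX θ0 eps0 eps1 Mm.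
have [_ [M1 _]] := Mm.
have cp : 0 < c + 1 by rewrite addr_gt0.
exists ((c + 1) * (A * (U * L))); split; first by rewrite !mulr_gt0.
move=> f x y r r0 r4 xS xy; set ρ := (c + 1) * r.
have cr : 0 < c * r by exact: mulr_gt0.
have cr1 : r <= c * r by rewrite ler_peMl// ltW.
have rc : r * (4 * c) <= 1 by rewrite -ler_pdivlMr ?mulr_gt0// div1r.
have ρ0 : 0 < ρ by rewrite mulr_gt0.
have ρ1 : ρ <= 1 by rewrite /ρ; move: rc cr1; lra.
have rρ : r <= ρ by rewrite /ρ; move: cr r0; lra.
have h1 := HL _ _ r0 (le_trans rρ ρ1) xS.
have h2 := HU _ _ _ r0 r4 xy.
have G'fin : (m (k_ ρ) (cball dist y (2 * ρ)) < +oo)%E.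
  apply: le_lt_trans h2 _; rewrite lte_mul_pinfty ?lee_fin ?(ltW U0)//.
  by rewrite muleC lte_mul_pinfty ?mu_fin// lee_fin invr_ge0 powR_ge0.
have G0 : (0 < m (k_ r) (cball dist x (2 * (c * r))))%E.
  have P0 : (0 < mu (cball dist x r) * ((r `^ θ)^-1)%:E)%E.
    by rewrite mule_gt0 ?mu_gt0// lte_fin invr_gt0 powR_gt0.
  by have := lt_le_trans P0 h1; rewrite pmule_rgt0 ?lte_fin.
have E : (Eosc (m (k_ r)) f (cball dist x (2 * (c * r))) <=
   (A * (U * L))%:E * Eosc (m (k_ ρ)) f (cball dist y (2 * ρ)))%E.
  apply: Eosc_le => //; first exact: mulr_gt0.
  - apply: HA; first exact: HJ.
    apply: leq_trans (leq_addr _ _); exact: kidx_le.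
  - apply: cball_sub => //; rewrite dist_sym /ρ; move: xy cr r0; lra.
  - by apply: le_trans h2 _; rewrite EFinM -muleA lee_wpmul2l// lee_fin ltW.
have -> : tEosc dist (m (k_ r)) f x (c * r) =
    Eosc (m (k_ r)) f (cball dist x (2 * (c * r))).
  by rewrite /tEosc M1 asboolT.
(* The point of [S] in [cB] is within [cr + r = ρ] of [y], so [tEosc] at [y] is not in its zero
   case. *)
have tE : tEosc dist (m (k_ ρ)) f y ρ = Eosc (m (k_ ρ)) f (cball dist y (2 * ρ)).
  rewrite /tEosc M1 asboolT//; case: xS => s [/= xs Ss]; exists s; split => //.
  apply: (@cball_sub _ _ _ _ mX y x ρ (c * r)) => //.
  by rewrite dist_sym /ρ; move: xy cr r0; lra.
have S1 : ((ρ^-1)%:E * Eosc (m (k_ ρ)) f (cball dist y (2 * ρ)) <= sharp dist eps m f y)%E.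
  by rewrite -tE; apply: ereal_sup_ubound; exists ρ => //=; rewrite ρ0 ρ1.
apply: (@le_trans _ _ (r^-1%:E * ((A * (U * L))%:E * Eosc (m (k_ ρ)) f (cball dist y (2 * ρ)))))%E.
  by rewrite lee_wpmul2l// lee_fin invr_ge0 ltW.
apply: le_trans (lee_wpmul2l _ S1); last by rewrite lee_fin !mulr_ge0 ?ltW// mulr_gt0.
rewrite !muleA -!EFinM (_ : _ / ρ = r^-1 * (A * (U * L)))// /ρ.
by field; rewrite !gt_eqF.
Qed.

End balls.

(** * Sums over nice families: small and large balls *)

Section families.
Context {R : realType} {d : measure_display} {X : measurableType d}.
Variables (dist : X -> X -> R) (mu : {measure set X -> \bar R}).
Variables (p θ eps c : R) (S : set X) (m : nat -> {measure set X -> \bar R}).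
Hypotheses (mmsX : mm_space dist mu) (dblX : unif_loc_doubling dist mu).
Hypotheses (p1 : 1 < p).
Hypotheses (θ0 : 0 <= θ) (eps0 : 0 < eps) (eps10 : eps <= 10^-1).
Hypotheses (Mm : Mfam dist mu θ S eps m) (c1 : 1 <= c).

Let mX : is_metric dist. Proof. by case: mmsX => -[]. Qed.
Let sX : dseparable dist. Proof. by case: mmsX => -[]. Qed.
Let bX : borel_sigma dist. Proof. by case: mmsX => -[]. Qed.
Let dist_sym x y : dist x y = dist y x. Proof. by case: mX. Qed.
Let distxx x : dist x x = 0. Proof. by case: mX => _ /(_ x x) [_ ->]. Qed.
Let eps2 : eps <= 2^-1. Proof. by apply: le_trans eps10 _; lra. Qed.
Let eps1 : eps <= 1. Proof. by apply: le_trans eps10 _; lra. Qed.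
Let mball x r : measurable (cball dist x r). Proof. exact: measurable_cball. Qed.
Let c0 : 0 < c. Proof. exact: lt_le_trans c1. Qed.
Let p0 : 0 < p. Proof. exact: lt_trans p1. Qed.
Let mu_gt0 x r : 0 < r -> (0 < mu (cball dist x r))%E.
Proof. by case: mmsX => _ [h _] /(h x) /andP[]. Qed.
Let mu_fin x r : 0 < r -> (mu (cball dist x r) < +oo)%E.
Proof. by case: mmsX => _ [h _] /(h x) /andP[]. Qed.

Lemma Eosc_ge0 (n : {measure set X -> \bar R}) f G : (0 <= Eosc n f G)%E.
Proof.
apply: le_ereal_inf_tmp => _ [a _ <-].
by rewrite mule_ge0 ?integral_ge0// lee_fin invr_ge0 fine_ge0.
Qed.

Lemma tEosc_ge0 (n : {measure set X -> \bar R}) f x r : (0 <= tEosc dist n f x r)%E.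
Proof. by rewrite /tEosc; case: ifP => // _; exact: Eosc_ge0. Qed.

Let term f x r := (mu (cball dist x r) * (r `^ (- p))%:E *
   poweR (tEosc dist (m (kidx eps r)) f x (c * r)) p)%E.

Let term_ge0 f x r : (0 <= term f x r)%E.
Proof. by rewrite !mule_ge0 ?poweR_ge0// lee_fin powR_ge0. Qed.

(** [D] is left free in order to serve both estimates, once as the whole space and once as the
    neighbourhood of [S]; [P] selects the small balls of a family. Passing to half balls costs a
    doubling constant. *)
Lemma small_balls_sum_le : exists K : R, 0 < K /\
  forall f n (ctr : 'I_n -> X) rad (P : pred 'I_n) δ (D : set X),
    nice dist S c δ ctr rad -> (forall i, P i -> rad i <= (4 * c)^-1) ->
    (forall i, P i -> cball dist (ctr i) (rad i / 2) `<=` D) ->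
    (\sum_(i < n | P i) term f (ctr i) (rad i) <=
     K%:E * \int[mu]_(x in D) poweR `|sharp dist eps m f x| p)%E.
Proof.
have c4 : 0 < (4 * c)^-1 by rewrite invr_gt0 mulr_gt0.
have [Dc [Dc0 HD]] := doubling_ball _ mX bX _ dblX 2 _ c4.
have [C [C0 HC]] := tEosc_le_sharp _ _ _ _ _ _ _ mmsX dblX θ0 eps0 eps10 Mm c1.
exists (Dc * C `^ p); split; first by rewrite mulr_gt0 ?powR_gt0.
move=> f n ctr rad P δ D [r0 [dB [_ BS]]] Pr PD.
(* By [tEosc_le_sharp], for a selected small ball [a i] is a lower bound for the [p]-th power of
   [sharp] on the whole ball. *)
pose a i := poweR (C^-1%:E * ((rad i)^-1%:E *
  tEosc dist (m (kidx eps (rad i))) f (ctr i) (c * rad i)))%E p.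
pose B i := cball dist (ctr i) (rad i / 2).
have sub i : B i `<=` cball dist (ctr i) (rad i).
  by apply: cball_sub => //; rewrite distxx add0r ler_pdivrMr// ler_peMr ?ler1n// ltW.
have tle i : P i -> (term f (ctr i) (rad i) <= (Dc * C `^ p)%:E * (a i * mu (B i)))%E.
  move=> Pi; have h : (mu (cball dist (ctr i) (rad i)) <= Dc%:E * mu (B i))%E.
    apply: HD; first by rewrite divr_gt0.
      apply: le_trans (Pr i Pi); rewrite ler_pdivrMr// ler_peMr ?ler1n//.
      exact: ltW.
    by rewrite distxx add0r mulrC divfK.
  rewrite /term -muleA.
  have t0 := tEosc_ge0 (m (kidx eps (rad i))) f (ctr i) (c * rad i).
  apply: le_trans (lee_wpmul2r _ h) _.
    by rewrite mule_ge0 ?poweR_ge0// lee_fin powR_ge0.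
  rewrite (_ : _ * poweR _ p = (C `^ p)%:E * a i)%E; last first.
    rewrite /a poweRM ?mule_ge0 ?lee_fin ?invr_ge0 ?(ltW C0) ?(ltW (r0 i))//.
    rewrite poweRM ?lee_fin ?invr_ge0 ?(ltW (r0 i))// !muleA; congr (_ * _)%E.
    rewrite !poweR_EFin -!EFinM; congr EFin.
    rewrite -powRM ?invr_ge0 ?(ltW C0)// mulfV ?gt_eqF// powR1 mul1r.
    by rewrite -powR_inv1 ?(ltW (r0 i))// -powRrM mulN1r.
  by rewrite EFinM [(a i * _)%E]muleC -!muleA [(mu _ * (_ * _))%E]muleCA.
apply: le_trans (lee_sum _ tle) _.
have a0 i : (0 <= a i)%E by exact: poweR_ge0.
rewrite -ge0_sume_distrr; last by move=> i _; rewrite mule_ge0.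
rewrite lee_wpmul2l ?lee_fin ?mulr_ge0 ?powR_ge0 ?(ltW Dc0)//.
apply: sum_measure_le_integral => //.
- by move=> i; exact: mball.
- move=> i j ij; rewrite -subset0 -(dB _ _ ij).
  by apply: setISS; exact: sub.
- by move=> x _; exact: poweR_ge0.
- move=> i x Pi Bx; split; first exact: PD Bx.
  apply: gt0_ler_poweR; rewrite ?in_itv/= ?leey ?andbT ?abse_ge0//; first exact: ltW.
    by rewrite !mule_ge0 ?tEosc_ge0// lee_fin invr_ge0 ltW.
  apply: le_trans (lee_abs _); rewrite lee_pdivrMl//.
  by apply: HC => //; [exact: Pr|exact: sub].
Qed.

Let large_ball_term_le : exists K : R, 0 < K /\
  forall f x r, measurable_fun setT f -> (4 * c)^-1 < r -> r <= 1 ->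
    cball dist x (c * r) `&` S !=set0 ->
    (term f x r <= K%:E * \int[m 0%N]_(y in cball dist x (2 * (c * r))) poweR `|f y|%:E p)%E.
Proof.
have c4 : 0 < 4 * c by rewrite mulr_gt0.
have [L [L0 HL]] := Mfam_ball_ge _ _ _ _ _ _ _ mmsX dblX θ0 eps0 eps10 Mm c1.
have [J HJ] := kidx_close _ eps0 eps2 (4 * c).
(* Since [r <= 1 <= 4cr], the index of [r] is at most [k(1) + J], so all the measures involved
   compare with [m 0]. *)
have [A [A0 HA]] := Mfam_compare _ _ _ _ _ _ (kidx eps 1 + J) mX sX bX θ0 eps0 eps1 Mm.
have [_ [M1 _]] := Mm.
exists (L * (4 * c) `^ p * A); split; first by rewrite !mulr_gt0 ?powR_gt0.
move=> f x r mf r4 r1 xS.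
have r0 : 0 < r by apply: lt_trans r4; rewrite invr_gt0.
rewrite /term; set k := kidx eps r; set G := cball dist x (2 * (c * r)).
have -> : tEosc dist (m k) f x (c * r) = Eosc (m k) f G.
  by rewrite /tEosc M1 asboolT.
have If0 (n : {measure set X -> \bar R}) : (0 <= \int[n]_(y in G) poweR `|f y|%:E p)%E.
  by apply: integral_ge0 => y _; exact: poweR_ge0.
have RHS0 : (0 <= (L * (4 * c) `^ p * A)%:E * \int[m 0%N]_(y in G) poweR `|f y|%:E p)%E.
  by rewrite mule_ge0// lee_fin !mulr_ge0 ?powR_ge0 ?ltW.
have muL : (mu (cball dist x r) <= L%:E * m k G)%E.
  apply: le_trans (HL _ _ r0 r1 xS); rewrite lee_pemulr// lee_fin.
  rewrite invf_ge1 ?powR_gt0//.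
  apply: (@le_trans _ _ (1 `^ θ)); last by rewrite powR1.
  by apply: ge0_ler_powR => //; rewrite nnegrE ltW.
have G0 : (0 < m k G)%E.
  by have := lt_le_trans (mu_gt0 x _ r0) muL; rewrite pmule_rgt0 ?lte_fin.
have E0 := Eosc_ge0 (m k) f G.
have Ele : (Eosc (m k) f G <= ((fine (m k G))^-1)%:E * \int[m k]_(y in G) `|f y|%:E)%E.
  by apply: ereal_inf_lbound; exists 0 => //; under eq_integral do rewrite subr0.
(* If the mass is infinite, [fine] sends it to 0, whose inverse is 0; the oscillation is then 0 and
   the term vanishes. *)
have [Gy|Gy] := eqVneq (m k G) +oo%E.
  have -> : Eosc (m k) f G = 0%E.
    by apply/eqP; rewrite eq_le E0 andbT; move: Ele; rewrite Gy/= invr0 mul0e.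
  by rewrite poweR0r ?gt_eqF// mule0.
have {}Gy : (m k G < +oo)%E by rewrite ltey.
have Gf : m k G \is a fin_num by rewrite ge0_fin_numE.
have fG0 : 0 < fine (m k G) by rewrite fine_gt0// G0.
have Ep : (poweR (Eosc (m k) f G) p <=
    ((fine (m k G))^-1)%:E * \int[m k]_(y in G) poweR `|f y|%:E p)%E.
  apply: le_trans (poweR_mean_le _ _ _ _ p1 (mball _ _) mf G0 Gy).
  apply: gt0_ler_poweR; rewrite ?in_itv/= ?leey ?andbT//; first exact: ltW.
  by rewrite mule_ge0 ?integral_ge0// lee_fin invr_ge0 ltW.
have kA : (\int[m k]_(y in G) poweR `|f y|%:E p <=
    A%:E * \int[m 0%N]_(y in G) poweR `|f y|%:E p)%E.
  apply: ge0_integral_le_scale; [exact: ltW| |by move=> y _; exact: poweR_ge0].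
  apply: HA => //; rewrite add0n; apply: HJ => //.
  by rewrite mulrC -ler_pdivrMr// mul1r ltW.
have rp : r `^ (- p) <= (4 * c) `^ p.
  rewrite powRN -powR_inv1 ?powR_ge0// -powRrM mulrC powRrM powR_inv1 ?(ltW r0)//.
  apply: ge0_ler_powR; rewrite ?nnegrE ?invr_ge0 ?ltW//.
  by rewrite invf_plt ?posrE.
apply: (@le_trans _ _ ((L%:E * m k G) * ((4 * c) `^ p)%:E *
   (((fine (m k G))^-1)%:E * (A%:E * \int[m 0%N]_(y in G) poweR `|f y|%:E p)))%E).
  apply: lee_pmul; rewrite ?poweR_ge0//.
  - by rewrite mule_ge0// lee_fin powR_ge0.
  - by apply: lee_pmul => //; rewrite lee_fin ?powR_ge0.
  - apply: le_trans Ep _; rewrite lee_wpmul2l// lee_fin invr_ge0 ltW//.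
rewrite -{1}(fineK Gf) !muleA -!EFinM; apply: lee_wpmul2r => //.
rewrite lee_fin le_eqVlt; apply/orP; left; apply/eqP.
by field; rewrite gt_eqF.
Qed.

(** Volume counting: the balls whose dilation contains [x] are disjoint and lie in one ball of fixed
    radius [W] about [x], and each carries at least the fraction [1/N] of its measure. *)
Let large_balls_overlap : exists N : R, 0 < N /\
  forall n (ctr : 'I_n -> X) rad (P : pred 'I_n),
    nice dist S c 1 ctr rad -> (forall i, P i -> (4 * c)^-1 < rad i) ->
    forall x, \sum_(i < n | P i) \1_(cball dist (ctr i) (2 * (c * rad i))) x <= N.
Proof.
have c4 : 0 < 4 * c by rewrite mulr_gt0.
(* [W] bounds [2cr + r] for [r <= 1]. Since [4cr > 1], also [2cr + W <= (2c + 4cW) r], which gives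
   the dilation factor passed to [doubling_ball]. *)
pose W := 2 * c + 1; have W0 : 0 < W by rewrite addr_gt0// mulr_gt0.
have [N [N0 HN]] := doubling_ball _ mX bX _ dblX (2 * c + W * (4 * c)) _ ltr01.
exists N; split => // n ctr rad P [r0 [dB [r1 _]]] Pr x.
pose Q i := P i && (x \in cball dist (ctr i) (2 * (c * rad i))).
have -> : \sum_(i < n | P i) \1_(cball dist (ctr i) (2 * (c * rad i))) x =
    \sum_(i < n | Q i) (1 : R).
  by rewrite big_mkcondr/=; apply: eq_bigr => i _; rewrite indicE; case: (_ \in _).
have Qd i : Q i -> dist (ctr i) x <= 2 * (c * rad i) by case/andP => _ /set_mem.
have cr i : c * rad i <= c by rewrite ler_piMr ?r1// ltW.
have sumB : (\sum_(i < n | Q i) mu (cball dist (ctr i) (rad i)) <= mu (cball dist x W))%E.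
  rewrite -[leRHS]mul1e -integral_cst//; under eq_bigr do rewrite -[mu _]mul1e.
  apply: sum_measure_le_integral => // i y Qi By; split => //.
  apply: cball_sub By => //; rewrite dist_sym /W.
  by have := Qd _ Qi; have := cr i; have := r1 i; lra.
have WN i : Q i -> (mu (cball dist x W) <= N%:E * mu (cball dist (ctr i) (rad i)))%E.
  move=> Qi; apply: HN => //; have Pi : P i by case/andP: Qi.
  have r4 : 1 <= 4 * c * rad i by rewrite mulrC -ler_pdivrMr// mul1r ltW ?Pr.
  rewrite mulrDl -!mulrA lerD ?Qd// -[leLHS]mulr1 ler_pM2l// mulrA//.
have mW : mu (cball dist x W) \is a fin_num by rewrite ge0_fin_numE ?mu_fin.
have V0 : 0 < fine (mu (cball dist x W)) by rewrite fine_gt0// mu_gt0 ?mu_fin.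
rewrite -(ler_pM2r V0) -lee_fin [leRHS]EFinM fineK// mulr_suml -sumEFin.
apply: le_trans (lee_wpmul2l _ sumB); last by rewrite lee_fin ltW.
rewrite ge0_sume_distrr; last by [].
by apply: lee_sum => i Qi; rewrite mul1r fineK// WN.
Qed.

Lemma large_balls_sum_le : exists K : R, 0 < K /\
  forall f n (ctr : 'I_n -> X) rad (P : pred 'I_n), measurable_fun setT f ->
    nice dist S c 1 ctr rad -> (forall i, P i -> (4 * c)^-1 < rad i) ->
    (\sum_(i < n | P i) term f (ctr i) (rad i) <=
     K%:E * \int[m 0%N]_x poweR `|f x|%:E p)%E.
Proof.
have [K [K0 HK]] := large_ball_term_le; have [N [N0 HN]] := large_balls_overlap.
exists (K * N); split; first exact: mulr_gt0.
move=> f n ctr rad P mf nS Pr; have [_ [_ [r1 BS]]] := nS.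
apply: (@le_trans _ _ (\sum_(i < n | P i) K%:E * \int[m 0%N]_(y in
    cball dist (ctr i) (2 * (c * rad i))) poweR `|f y|%:E p)%E).
  by apply: lee_sum => i Pi; apply: HK => //; exact: Pr.
rewrite -ge0_sume_distrr; last first.
  by move=> i _; apply: integral_ge0 => y _; exact: poweR_ge0.
rewrite EFinM -muleA lee_wpmul2l ?lee_fin ?(ltW K0)//.
apply: sum_integral_overlap_le => //; first exact: ltW.
- apply: (measurableT_comp (measurable_poweR _)).
  by apply/measurable_EFinP; exact: measurableT_comp.
- by move=> x; exact: poweR_ge0.
- exact: HN.
Qed.

End families.

(** * Assembly of the two estimates *)

Theorem mainTheorem14 (R : realType) (d : measure_display) (X : measurableType d)
  (dist : X -> X -> R) (mu : {measure set X -> \bar R})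
  (p θ eps c : R) (S : set X) (m : nat -> {measure set X -> \bar R}) :
  mm_space dist mu ->
  1 < p ->
  in_A dist p mu ->
  0 <= θ -> θ < p ->
  LCR dist mu θ S ->
  dclosed dist S ->
  0 < eps -> eps <= 10^-1 ->
  Mfam dist mu θ S eps m ->
  1 <= c ->
  (exists C : R, 0 < C /\
     forall f, L1loc dist m f ->
       (BSN dist mu eps m S p c 1 f <= C%:E * CN dist mu eps m p f)%E) /\
  (forall δ : R, 0 < δ -> δ <= (4 * c)^-1 ->
     exists Cδ : R, 0 < Cδ /\
       forall f, L1loc dist m f ->
         (Lnorm (m 0%N) p%:E (EFin \o f) < +oo)%E ->
         (`| BSN dist mu eps m S p c δ f - Lnorm (m 0%N) p%:E (EFin \o f) |
            <= Cδ%:E * LpD mu (Unbhd dist S ((c + 1) * δ)) p (sharp dist eps m f))%E).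
Proof.
move=> mmsX p1 [dblX _] θ0 _ _ _ eps0 eps10 Mm c1.
have p0 : 0 < p by exact: lt_trans p1.
have pV0 : 0 < p^-1 by rewrite invr_gt0.
have [K [K0 HK]] := small_balls_sum_le _ _ _ _ _ _ _ _ mmsX dblX p1 θ0 eps0 eps10 Mm c1.
have [K' [K'0 HK']] := large_balls_sum_le _ _ _ _ _ _ _ _ mmsX dblX p1 θ0 eps0 eps10 Mm c1.
have root_le (x y : \bar R) (C : R) : 0 < C -> (0 <= x)%E -> (0 <= y)%E ->
    (x <= C%:E * y)%E -> (poweR x p^-1 <= (C `^ p^-1)%:E * poweR y p^-1)%E.
  move=> C0 x0 y0 xy; rewrite -poweR_EFin -poweRM ?lee_fin ?(ltW C0)//.
  apply: gt0_ler_poweR; rewrite ?in_itv/= ?leey ?andbT//; first exact: ltW.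
  by rewrite mule_ge0// lee_fin ltW.
have I0 (n : {measure set X -> \bar R}) D (g : X -> \bar R) :
    (0 <= \int[n]_(x in D) poweR `|g x| p)%E.
  by apply: integral_ge0 => x _; exact: poweR_ge0.
have term_ge0 f x r : (0 <= mu (cball dist x r) * (r `^ (- p))%:E *
    poweR (tEosc dist (m (kidx eps r)) f x (c * r)) p)%E.
  by rewrite !mule_ge0 ?poweR_ge0// lee_fin powR_ge0.
split.
  set a := K `^ p^-1; set b := K' `^ p^-1; set e := 2 `^ p^-1 : R.
  have a0 : 0 <= a by exact: powR_ge0.
  have b0 : 0 <= b by exact: powR_ge0.
  have e0 : 0 <= e by exact: powR_ge0.
  (* The 1 is for the norm of [f] itself, [a] for the small balls, [b] for the large ones, and [e]
     for splitting the [p]-th root of their sum. *)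
  exists (1 + e * (a + b)); split.
    by rewrite (lt_le_trans ltr01)// lerDl mulr_ge0// addr_ge0.
  move=> f [mf _]; rewrite /BSN /CN.
  set N := Lnorm (m 0%N) _ _; set F := Lnorm mu _ _.
  have N0 : (0 <= N)%E by exact: Lnorm_ge0.
  have F0 : (0 <= F)%E by exact: Lnorm_ge0.
  rewrite EFinD ge0_muleDl ?lee_fin ?mulr_ge0 ?addr_ge0// mul1e.
  apply: leeD; first by rewrite leeDl.
  apply: ge_ereal_sup => _ [n [ctr [rad [nS ->]]]].
  rewrite (bigID (fun i => rad i <= (4 * c)^-1))/=.
  apply: le_trans (poweRD_le _ _ _ (ltW pV0) _ _) _; try exact: sume_ge0.
  rewrite EFinM -muleA lee_wpmul2l//.
  apply: (@le_trans _ _ (a%:E * F + b%:E * N)%E).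
    apply: leeD; rewrite /F /N Lnorm.unlock; apply: root_le; rewrite ?sume_ge0//.
      exact: (HK _ _ _ _ _ _ _ nS).
    by apply: HK' => // i; rewrite -ltNge.
  rewrite EFinD ge0_muleDl ?lee_fin//; apply: leeD; rewrite lee_wpmul2l ?lee_fin//.
    by rewrite leeDr.
  by rewrite leeDl.
move=> δ δ0 δ4; exists (K `^ p^-1); split; first by rewrite powR_gt0.
move=> f _ Nf; rewrite /BSN; set N := Lnorm _ _ _ in Nf *; set s := ereal_sup _.
(* The empty family is nice and contributes 0. *)
have s0 : (0 <= s)%E.
  have noI (i : 'I_0) : False by case: i.
  apply: ereal_sup_ubound.
  exists 0%N, (fun i => False_rect X (noI i)), (fun i => False_rect R (noI i)).
  split; last by rewrite big_ord0 poweR0r// gt_eqF.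
  by do 3?[split=> [i|]; first by case: (noI i)] => i; case: (noI i).
have Nfin : N \is a fin_num by rewrite ge0_fin_numE ?Lnorm_ge0.
(* Finiteness of [N] allows it to cancel in the extended reals, which leaves the supremum alone. *)
rewrite addeAC subee// add0e gee0_abs//.
apply: ge_ereal_sup => _ [n [ctr [rad [nS ->]]]].
apply: root_le => //; first exact: sume_ge0.
have [r0 [_ [rδ BS]]] := nS.
apply: (HK _ _ _ _ _ _ _ nS) => i _; first exact: le_trans (rδ i) δ4.
have [_ _ dsym dtri] : is_metric dist by case: mmsX => -[].
(* A point of the half ball is at distance at most [r/2 + cr < (c+1)δ] from [s']; the halving makes
   the inequality strict. *)
have [s' [/= xs Ss]] := BS i; move=> y; rewrite /cball/= in xs * => xy.
apply: (@le_lt_trans _ _ (dist y s')%:E).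
  by apply: ereal_inf_lbound; exists s'.
rewrite lte_fin; have := dtri y (ctr i) s'; rewrite (dsym y (ctr i)).
have : c * rad i <= c * δ by rewrite ler_pM2l ?rδ// (lt_le_trans ltr01).
by have := r0 i; have := rδ i; move: xs xy; lra.
Qed.
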